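(* Let $\mathcal{D}$ be a dialgebra over a field $K$ of characteristic zero, and let $\mathrm{Bider}(\mathcal{D})=\mathrm{Dider}(\mathcal{D})\oplus\mathrm{Der}(\mathcal{D})$. Then $(\mathrm{Bider}(\mathcal{D}),\langle\cdot,\cdot\rangle)$ is a Leibniz algebra, where the bracket is defined by $$\langle \delta\oplus d,\ \delta'\oplus d'\rangle := [\delta,d']\oplus[d,d']$$ for $\delta,\delta'\in\mathrm{Dider}(\mathcal{D})$ and $d,d'\in\mathrm{Der}(\mathcal{D})$.
   Context: A dialgebra over $K$ is a $K$-vector space $\mathcal{D}$ with two bilinear associative products $\vdash,\dashv:\mathcal{D}\times\mathcal{D}\to\mathcal{D}$ satisfying, for all $x,y,z\in\mathcal{D}$: $x\dashv(y\dashv z)=x\dashv(y\vdash z)$, $(x\dashv y)\vdash z=(x\vdash y)\vdash z$, and $x\vdash(y\dashv z)=(x\vdash y)\dashv z$. A derivation of $\mathcal{D}$ is a $K$-linear map $d:\mathcal{D}\to\mathcal{D}$ such that $d(a*b)=d(a)*b+a*d(b)$ for all $a,b\in\mathcal{D}$ and for each $*\in\{\vdash,\dashv\}$. A diderivation of $\mathcal{D}$ is a $K$-linear map $\delta:\mathcal{D}\to\mathcal{D}$ such that $\delta(a*b)=\delta(a)\dashv b+a\vdash\delta(b)$ for all $a,b\in\mathcal{D}$ and for each $*\in\{\vdash,\dashv\}$. $\mathrm{Der}(\mathcal{D})$ and $\mathrm{Dider}(\mathcal{D})$ are the vector spaces of all derivations and of all diderivations of $\mathcal{D}$; the direct sum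 is the external direct sum. $[S,T]=ST-TS$ denotes the commutator of linear maps; $[\delta,d']$ is a diderivation whenever $\delta$ is a diderivation and $d'$ is a derivation. A Leibniz algebra is a $K$-vector space $\mathcal{L}$ with a bilinear product $[\cdot,\cdot]$ satisfying $[x,[y,z]]=[[x,y],z]-[[x,z],y]$ for all $x,y,z\in\mathcal{L}$. *)

(* Defs.v *)
From HB Require Import structures.
From mathcomp Require Import all_boot all_algebra.
From mathcomp Require Import sesquilinear boolp functions.

Set Implicit Arguments.
Unset Strict Implicit.
Unset Printing Implicit Defensive.

Import GRing.Theory.

Local Open Scope ring_scope.

Reserved Notation "x ⊢ y" (at level 40, left associativity).
Reserved Notation "x ⊣ y" (at level 40, left associativity).

HB.mixin Record Lmodule_isDialgebra (K : fieldType) D of GRing.Lmodule K D := {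
  vdash : D -> D -> D;
  dashv : D -> D -> D;
  vdash_bilinear : bilinear_for *:%R *:%R vdash;
  dashv_bilinear : bilinear_for *:%R *:%R dashv;
  vdashA : associative vdash;
  dashvA : associative dashv;
  dashv_bar : forall x y z, dashv x (dashv y z) = dashv x (vdash y z);
  vdash_bar : forall x y z, vdash (dashv x y) z = vdash (vdash x y) z;
  vdash_dashvA : forall x y z, vdash x (dashv y z) = dashv (vdash x y) z
}.

#[short(type="dialgebraType")]
HB.structure Definition Dialgebra (K : fieldType) :=
  { D of Lmodule_isDialgebra K D & GRing.Lmodule K D }.

Notation "x ⊢ y" := (vdash x y) : ring_scope.
Notation "x ⊣ y" := (dashv x y) : ring_scope.

HB.instance Definition _ (K : fieldType) (D : dialgebraType K) :=
  bilinear_isBilinear.Build K D D D *:%R *:%R (@vdash K D) vdash_bilinear.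
HB.instance Definition _ (K : fieldType) (D : dialgebraType K) :=
  bilinear_isBilinear.Build K D D D *:%R *:%R (@dashv K D) dashv_bilinear.

(* [\o] and [-] are left-associative at the same level, hence the parentheses. *)
Definition commutator (K : fieldType) (V : lmodType K) (S T : V -> V) : V -> V :=
  (S \o T) - (T \o S).

Definition is_leibniz_algebra (K : fieldType) (L : lmodType K)
    (br : L -> L -> L) : Prop :=
  bilinear_for *:%R *:%R br /\
  (forall x y z, br x (br y z) = br (br x y) z - br (br x z) y).

Section Derivations.
Variables (K : fieldType) (D : dialgebraType K).

Definition is_derivation (d : D -> D) : Prop :=
  [/\ linear d,
      forall a b, d (a ⊢ b) = d a ⊢ b + a ⊢ d b
    & forall a b, d (a ⊣ b) = d a ⊣ b + a ⊣ d b].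

Definition is_diderivation (delta : D -> D) : Prop :=
  [/\ linear delta,
      forall a b, delta (a ⊢ b) = delta a ⊣ b + a ⊢ delta b
    & forall a b, delta (a ⊣ b) = delta a ⊣ b + a ⊢ delta b].

Definition der_pred : {pred D -> D} := fun d => `[< is_derivation d >].
Definition dider_pred : {pred D -> D} := fun d => `[< is_diderivation d >].

Lemma der_predP d : reflect (is_derivation d) (d \in der_pred).
Proof. exact: asboolP. Qed.

Lemma dider_predP d : reflect (is_diderivation d) (d \in dider_pred).
Proof. exact: asboolP. Qed.

Lemma commutatorE (S T : D -> D) x : commutator S T x = S (T x) - T (S x).
Proof. by []. Qed.

Lemma linear_add (f : D -> D) : linear f -> {morph f : x y / x + y}.
Proof. by move=> lf x y; have := lf 1 x y; rewrite !scale1r. Qed.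

Lemma linear_fun0 : linear (0 : D -> D).
Proof. by move=> k x y; rewrite /= scaler0 addr0. Qed.

Lemma linear_funDZ (k : K) (f g : D -> D) :
  linear f -> linear g -> linear (k *: f + g).
Proof.
move=> lf lg l x y; rewrite !addrfctE !scalrfctE lf lg.
by rewrite !scalerDr !scalerA (mulrC k) addrACA.
Qed.

Lemma linear_commutator (S T : D -> D) :
  linear S -> linear T -> linear (commutator S T).
Proof.
move=> lS lT k x y; rewrite !commutatorE lT lS lS lT.
by rewrite scalerBr opprD addrACA.
Qed.

Lemma der_pred_submod_closed : submod_closed der_pred.
Proof.
split=> [|k f g /der_predP[lf fl fr] /der_predP[lg gl gr]]; apply/der_predP.
  by split=> [|a b|a b]; rewrite ?linear0l ?linear0r ?addr0 //;
    exact: linear_fun0.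
split=> [|a b|a b]; first exact: linear_funDZ.
  rewrite !addrfctE !scalrfctE fl gl linearDl linearDr linearZl_LR linearZr_LR.
  by rewrite scalerDr addrACA.
rewrite !addrfctE !scalrfctE fr gr linearDl linearDr linearZl_LR linearZr_LR.
by rewrite scalerDr addrACA.
Qed.

Lemma dider_pred_submod_closed : submod_closed dider_pred.
Proof.
split=> [|k f g /dider_predP[lf fl fr] /dider_predP[lg gl gr]];
  apply/dider_predP.
  by split=> [|a b|a b]; rewrite ?linear0l ?linear0r ?addr0 //;
    exact: linear_fun0.
split=> [|a b|a b]; first exact: linear_funDZ.
  rewrite !addrfctE !scalrfctE fl gl linearDl linearDr linearZl_LR linearZr_LR.
  by rewrite scalerDr addrACA.
rewrite !addrfctE !scalrfctE fr gr linearDl linearDr linearZl_LR linearZr_LR.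
by rewrite scalerDr addrACA.
Qed.

HB.instance Definition _ := GRing.isSubmodClosed.Build K (D -> D) der_pred
  der_pred_submod_closed.
HB.instance Definition _ := GRing.isSubmodClosed.Build K (D -> D) dider_pred
  dider_pred_submod_closed.

Lemma leibniz_cancel (p q r s t w : D) :
  p + q + (r + s) - (t + r + (q + w)) = p - t + (s - w).
Proof.
rewrite [p + q]addrC [t + r]addrC [q + p + _]addrACA [r + t + _]addrACA.
by rewrite [r + q]addrC opprD [LHS]addrACA subrr add0r opprD [LHS]addrACA.
Qed.

Lemma commutator_der_pred d d' :
  d \in der_pred -> d' \in der_pred -> commutator d d' \in der_pred.
Proof.
move=> /der_predP[ld dl dr] /der_predP[le el er]; apply/der_predP.
split=> [|a b|a b]; first exact: linear_commutator.
  rewrite !commutatorE el dl (linear_add ld) (linear_add le) !dl !el.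
  by rewrite linearBl linearBr leibniz_cancel.
rewrite !commutatorE er dr (linear_add ld) (linear_add le) !dr !er.
by rewrite linearBl linearBr leibniz_cancel.
Qed.

Lemma commutator_dider_pred delta d :
  delta \in dider_pred -> d \in der_pred -> commutator delta d \in dider_pred.
Proof.
move=> /dider_predP[ld dl dr] /der_predP[le el er]; apply/dider_predP.
split=> [|a b|a b]; first exact: linear_commutator.
  rewrite !commutatorE el dl (linear_add ld) (linear_add le) !dl el er.
  by rewrite linearBl linearBr leibniz_cancel.
rewrite !commutatorE er dr (linear_add ld) (linear_add le) !dr el er.
by rewrite linearBl linearBr leibniz_cancel.
Qed.

Record Der := MkDer { der_fun :> D -> D; der_funP : der_fun \in der_pred }.

HB.instance Definition _ := [isSub for der_fun].
HB.instance Definition _ := [Choice of Der by <:].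
HB.instance Definition _ := [SubChoice_isSubLmodule of Der by <:].

Record Dider :=
  MkDider { dider_fun :> D -> D; dider_funP : dider_fun \in dider_pred }.

HB.instance Definition _ := [isSub for dider_fun].
HB.instance Definition _ := [Choice of Dider by <:].
HB.instance Definition _ := [SubChoice_isSubLmodule of Dider by <:].

Definition der_comm (d d' : Der) : Der :=
  MkDer (commutator_der_pred (der_funP d) (der_funP d')).

Definition dider_comm (delta : Dider) (d : Der) : Dider :=
  MkDider (commutator_dider_pred (dider_funP delta) (der_funP d)).

(* External direct sum, with the componentwise vector space structure. *)
Definition Bider : lmodType K := (Dider * Der)%type.

Definition bider_bracket (x y : Bider) : Bider :=
  (dider_comm x.1 y.2, der_comm x.2 y.2).

End Derivations.

(* Main.v *)
Require Import Defs.
From mathcomp Require Import all_boot all_algebra.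
From mathcomp Require Import sesquilinear boolp functions.

(** Both components of the bracket are commutators of linear maps in which the
    right factor is a derivation: the bracket sends [x] and [y] to
    [(commutator x.1 y.2, commutator x.2 y.2)].  The commutator is bilinear on
    linear maps, and the Leibniz identity for [x], [y], [z] reduces, in each
    component, to the Jacobi identity of the associative algebra of
    endomorphisms ([commutator_leibniz]), with [S] the component of [x] and
    with [T], [U] the derivations [y.2], [z.2].  Derivations and diderivations
    are subspaces of the space of all maps, so both facts need only be checked
    for linear endomorphisms of a vector space, where they hold in every
    characteristic. *)

Import GRing.Theory.

Local Open Scope ring_scope.

Section Commutator.
Variables (K : fieldType) (V : lmodType K).
Implicit Types S T U : V -> V.

Lemma linear_sub S : linear S -> {morph S : x y / x - y}.
Proof. by move=> lS x y; rewrite addrC -scaleN1r lS scaleN1r addrC. Qed.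

Lemma commutator_linearl (k : K) S S' T :
  linear T ->
  commutator (k *: S + S') T = k *: commutator S T + commutator S' T.
Proof.
move=> lT; apply: funext => v.
rewrite /commutator !(addrfctE, opprfctE, scalrfctE) /= lT.
by rewrite scalerBr opprD addrACA.
Qed.

Lemma commutator_linearr (k : K) S T T' :
  linear S ->
  commutator S (k *: T + T') = k *: commutator S T + commutator S T'.
Proof.
move=> lS; apply: funext => v.
rewrite /commutator !(addrfctE, opprfctE, scalrfctE) /= lS.
by rewrite scalerBr opprD addrACA.
Qed.

(** The Jacobi identity for endomorphisms, in the right Leibniz form. *)
Lemma commutator_leibniz S T U :
  linear S -> linear T -> linear U ->
  commutator S (commutator T U) =
    commutator (commutator S T) U - commutator (commutator S U) T.
Proof.
move=> lS lT lU; apply: funext => v.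
rewrite /commutator !(addrfctE, opprfctE) /=.
rewrite (linear_sub _ lS) (linear_sub _ lT) (linear_sub _ lU).
(* On the right, [T (S (U v))] and [U (S (T v))] occur with both signs. *)
rewrite !opprB [RHS]addrACA !subrKA.
by rewrite addrACA [- _ - _]addrC addrACA.
Qed.

End Commutator.

Section Bracket.
Variables (K : fieldType) (D : dialgebraType K).

Lemma linear_der (d : Der D) : linear d.
Proof. by have /der_predP[] := der_funP d. Qed.

Lemma linear_dider (delta : Dider D) : linear delta.
Proof. by have /dider_predP[] := dider_funP delta. Qed.

Lemma bider_bracket_bilinear :
  bilinear_for *:%R *:%R (@bider_bracket K D).
Proof.
split=> z k x y; congr pair; apply: val_inj; rewrite linearP /=.
- exact/commutator_linearl/linear_der.
- exact/commutator_linearl/linear_der.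
- exact/commutator_linearr/linear_dider.
- exact/commutator_linearr/linear_der.
Qed.

Lemma bider_bracket_leibniz (x y z : Bider D) :
  bider_bracket x (bider_bracket y z) =
    bider_bracket (bider_bracket x y) z - bider_bracket (bider_bracket x z) y.
Proof.
congr pair; apply: val_inj; rewrite linearB /=.
- by apply: commutator_leibniz;
    [exact: linear_dider | exact: linear_der | exact: linear_der].
- by apply: commutator_leibniz; exact: linear_der.
Qed.

End Bracket.

Theorem theorem5p1 (K : fieldType) (charK : [pchar K] =i pred0)
  (D : dialgebraType K) : is_leibniz_algebra (@bider_bracket K D).
Proof.
split; [exact: bider_bracket_bilinear | exact: bider_bracket_leibniz].
Qed.
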